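(* Let $p$ be a prime number and let $S$ be a saturated numerical semigroup with multiplicity $p$ and conductor $c \equiv 0 \pmod p$, and write $c = ph$ with $h$ a positive integer. Then the catenary degree of $S$ is $$C(S) = 2h+1.$$
   Context: Let $\mathbf{N}$ denote the set of non-negative integers. A numerical semigroup is a subset $S \subseteq \mathbf{N}$ that is closed under addition, contains $0$, and has finite complement in $\mathbf{N}$. The multiplicity of $S$ is the least positive element of $S$. The conductor of $S$ is the least integer $s$ such that $s+n \in S$ for all $n \in \mathbf{N}$. For $s \in S\setminus\{0\}$ put $d_S(s) = \gcd\{x \in S : x \le s\}$. $S$ is called saturated if $s + d_S(s) \in S$ for all $s \in S \setminus\{0\}$. Every numerical semigroup $S$ has a unique minimal system of generators $\{a_1 < a_2 < \dots < a_r\}$, which is finite. For $s \in S$, the set of factorizations of $s$ is $Z(s) = \{(n_1,\dots,n_r) \in \mathbf{N}^r : n_1 a_1 + \dots + n_r a_r = s\}$. For $x = (x_1,\dots,x_r) \in \mathbf{N}^r$ the length is $|x| = x_1 + \dots + x_r$. For $x,y \in \mathbf{N}^r$ put $\gcd(x,y) = (\min\{x_1,y_1\},\dots,\min\{x_r,y_r\})$ and $\mathrm{dist}(x,y) = \max\{|x-\gcd(x,y)|, |y-\gcd(x,y)|\}$. For $N \in \mathbf{N}$, an $N$-chain of factorizations of $s$ from $z$ to $z'$ is a finite sequence $z = z_0, z_1, \dots, z_n = z'$ in $Z(s)$ with $\mathrm{dist}(z_{i-1}, z_i) \le N$ for all $1 \le i \le n$. The catenary degree $C(s)$ of $s$ is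 the minimal $N \in \mathbf{N}$ such that any two factorizations of $s$ are joined by an $N$-chain. The catenary degree of $S$ is $C(S) = \sup\{C(s) : s \in S\}$. *)

(* Defs.v *)
From mathcomp Require Import all_boot all_order.
From mathcomp Require Import boolp classical_sets cardinality.

Set Implicit Arguments.
Unset Strict Implicit.
Unset Printing Implicit Defensive.

Local Open Scope classical_set_scope.
Local Open Scope nat_scope.

(* Meaningful for nonempty A only; the value is 0 on the empty set. *)
Definition minimum (A : set nat) : nat :=
  xget 0 [set n | A n /\ forall m, A m -> n <= m].

Lemma minimumP (A : set nat) :
  A !=set0 -> A (minimum A) /\ forall m, A m -> minimum A <= m.
Proof.
move=> [n An]; rewrite /minimum.
have exA : exists n, `[< A n >] by exists n; apply/asboolP.
apply: (xgetPex 0 (P := [set n | A n /\ forall m, A m -> n <= m])).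
exists (ex_minn exA); case: ex_minnP => k /asboolP Ak kmin; split=> // m Am.
by apply: kmin; apply/asboolP.
Qed.

Definition numerical_semigroup (S : set nat) : Prop :=
  [/\ S 0, forall x y, S x -> S y -> S (x + y) & finite_set (~` S)].

Definition multiplicity (S : set nat) : nat :=
  minimum [set s | S s /\ 0 < s].

Definition conductor (S : set nat) : nat :=
  minimum [set s | forall n, S (s + n)].

Definition gcd_upto (S : set nat) (s : nat) : nat :=
  \big[gcdn/0]_(x < s.+1 | (x : nat) \in S) (x : nat).

Definition saturated (S : set nat) : Prop :=
  forall s, S s -> 0 < s -> S (s + gcd_upto S s).

(* Elements of N^r, where r is the number of generators listed in a. *)
Notation exponents a := {ffun 'I_(size a) -> nat}.

Definition factorizations (a : seq nat) (s : nat) : set (exponents a) :=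
  [set n | \sum_(i < size a) n i * nth 0 a i = s].
Arguments factorizations : clear implicits.

Definition generates (a : seq nat) (S : set nat) : Prop :=
  forall s, S s <-> factorizations a s !=set0.

Definition is_minimal_generators (S : set nat) (a : seq nat) : Prop :=
  [/\ sorted ltn a, generates a S
    & forall b : seq nat, {subset b <= a} -> generates b S -> {subset a <= b}].

(* See minimal_generatorsP for existence and uniqueness. *)
Definition minimal_generators (S : set nat) : seq nat :=
  xget [::] [set a | is_minimal_generators S a].

Section Factorizations.
Variable a : seq nat.
Implicit Types x y z : exponents a.

Definition flength x : nat := \sum_(i < size a) x i.

Definition fgcd x y : exponents a := [ffun i => minn (x i) (y i)].

(* Truncated subtraction is only ever applied below to y <= x. *)
Definition fsub x y : exponents a := [ffun i => x i - y i].

Definition fdist x y : nat :=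
  maxn (flength (fsub x (fgcd x y))) (flength (fsub y (fgcd x y))).

(* The chain is z :: zs. *)
Definition is_chain (s N : nat) z z' : Prop :=
  exists zs : seq (exponents a),
    [/\ forall w, w \in z :: zs -> factorizations a s w,
        path (fun x y => fdist x y <= N) z zs
      & last z zs = z'].

Definition element_catenary_degree (s : nat) : nat :=
  minimum [set N | forall z z', factorizations a s z -> factorizations a s z' ->
                     is_chain s N z z'].

End Factorizations.

(* [supremum 0] is the least upper bound of a nonempty bounded set of naturals,
   and takes the default value 0 on an unbounded one; hence a nonzero value of
   catenary_degree is always a genuine supremum. *)
Definition catenary_degree (S : set nat) : nat :=
  supremum 0 [set element_catenary_degree (minimal_generators S) s | s in S].

Lemma factorizationsD (a : seq nat) s t x y :
  factorizations a s x -> factorizations a t y ->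
  factorizations a (s + t) [ffun i => x i + y i].
Proof.
rewrite /factorizations /= => <- <-; rewrite -big_split /=.
by apply: eq_bigr => i _; rewrite ffunE mulnDl.
Qed.

Lemma factorizations_mem (a : seq nat) s : s \in a -> factorizations a s !=set0.
Proof.
move=> sa; have lt_i : index s a < size a by rewrite index_mem.
exists [ffun i => (i == Ordinal lt_i) : nat]; rewrite /factorizations /=.
rewrite (bigD1 (Ordinal lt_i)) //= ffunE eqxx mul1n nth_index // big1 ?addn0 //.
by move=> i /negbTE ne; rewrite ffunE ne.
Qed.

Lemma factorizations_closed (a : seq nat) (T : set nat) s :
  T 0 -> (forall x y, T x -> T y -> T (x + y)) ->
  (forall x, x \in a -> x <= s -> T x) ->
  factorizations a s !=set0 -> T s.
Proof.
move=> T0 TD aT [x /= xs].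
have les (i : 'I_(size a)) : x i * nth 0 a i <= s.
  by rewrite -xs (bigD1 i) //= leq_addr.
rewrite -xs; elim/big_ind: _ => // i _.
have := les i; case: (x i) => [|k] le_k; first by rewrite mul0n.
have Tai : T (nth 0 a i).
  apply: aT; first by rewrite mem_nth.
  by apply: leq_trans le_k; rewrite mulSn leq_addr.
by elim: k {le_k} => [|k IH]; rewrite ?mul1n // mulSn; apply: TD.
Qed.

Lemma factorizations0 (a : seq nat) : factorizations a 0 !=set0.
Proof.
exists [ffun=> 0]; rewrite /factorizations /= big1 // => i _.
by rewrite ffunE mul0n.
Qed.

Lemma generates_sub (a b : seq nat) (S : set nat) :
  generates a S -> (forall x, x \in b -> S x) ->
  (forall x, x \in a -> factorizations b x !=set0) -> generates b S.
Proof.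
move=> ga bS ab s.
have S0 : S 0 by apply/ga/factorizations0.
have SD x y : S x -> S y -> S (x + y).
  by move=> /ga[u ux] /ga[v vy]; apply/ga; exists [ffun i => u i + v i];
     apply: factorizationsD.
split=> [/ga|].
  apply: (@factorizations_closed a [set t | factorizations b t !=set0]).
  - exact: factorizations0.
  - move=> x y [u ux] [v vy]; exists [ffun i => u i + v i].
    exact: factorizationsD.
  - by move=> x xa _; apply: ab.
by apply: factorizations_closed => // x xb _; apply: bS.
Qed.

Lemma generates_mem (a : seq nat) (S : set nat) x :
  generates a S -> x \in a -> S x.
Proof. by move=> ga xa; apply/ga/factorizations_mem. Qed.

Lemma minimal_generator_atom (S : set nat) a x :
  is_minimal_generators S a -> x \in a ->
  0 < x /\ forall y z, S y -> S z -> 0 < y -> 0 < z -> x <> y + z.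
Proof.
move=> [_ ga mina] xa.
have rem_gen : ~ (factorizations (filter (predC1 x) a) x !=set0).
  move=> xf; have/(_ _ xa) : {subset a <= filter (predC1 x) a}.
    apply: mina; first by move=> y; rewrite mem_filter => /andP[].
    apply: (generates_sub ga) => y.
      by rewrite mem_filter => /andP[_]; apply: generates_mem.
    have [-> _|ne ya] := eqVneq y x; first exact: xf.
    by apply: factorizations_mem; rewrite mem_filter /= ne.
  by rewrite mem_filter /= eqxx.
split; first by rewrite lt0n; apply/eqP => x0; apply: rem_gen; rewrite x0;
  exact: factorizations0.
have lt_gen y : S y -> y < x -> factorizations (filter (predC1 x) a) y !=set0.
  move=> /ga yf ltyx; move: yf.
  apply: (@factorizations_closed a
    [set t | factorizations (filter (predC1 x) a) t !=set0]).
  - exact: factorizations0.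
  - move=> u v [f fu] [g gv]; exists [ffun i => f i + g i].
    exact: factorizationsD.
  - move=> t ta ty; apply: factorizations_mem; rewrite mem_filter ta /= andbT.
    by rewrite neq_ltn (leq_ltn_trans ty ltyx).
move=> y z Sy Sz y0 z0 xyz; apply: rem_gen.
have [f fy] : factorizations (filter (predC1 x) a) y !=set0.
  by apply: lt_gen => //; rewrite xyz -addn1 leq_add2l.
have [g gz] : factorizations (filter (predC1 x) a) z !=set0.
  by apply: lt_gen => //; rewrite xyz -add1n leq_add2r.
exists [ffun i => f i + g i]; rewrite [in X in factorizations _ X]xyz.
exact: factorizationsD.
Qed.

Lemma atom_mem_generators (S : set nat) b x :
  generates b S -> S x -> 0 < x ->
  (forall y z, S y -> S z -> 0 < y -> 0 < z -> x <> y + z) -> x \in b.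
Proof.
move=> gb Sx x0 atx; apply/negPn/negP => xb.
have S0 : S 0 by apply/gb/factorizations0.
have SD u v : S u -> S v -> S (u + v).
  by move=> /gb[f fu] /gb[g gv]; apply/gb; exists [ffun i => f i + g i];
     apply: factorizationsD.
suff [] : [set t | S t /\ t <> x] x by [].
have/gb := Sx; apply: (@factorizations_closed b [set t | S t /\ t <> x]).
- by split=> // x00; rewrite -x00 in x0.
- move=> u v [Su ux] [Sv vx]; split; first exact: SD.
  have [->//|u0] := posnP u; have [->|v0] := posnP v; first by rewrite addn0.
  by move/esym; apply: atx.
- by move=> y yb _; split; [exact: generates_mem yb|move=> e; rewrite -e yb in xb].
Qed.

Lemma is_minimal_generators_uniq (S : set nat) a b :
  is_minimal_generators S a -> is_minimal_generators S b -> a = b.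
Proof.
move=> ma mb; have [sa ga _] := ma; have [sb gb _] := mb.
apply: (irr_sorted_eq ltn_trans ltnn sa sb) => x.
apply/idP/idP => [xa|xb].
  have [x0 atx] := minimal_generator_atom ma xa.
  exact: atom_mem_generators gb (generates_mem ga xa) x0 atx.
have [x0 atx] := minimal_generator_atom mb xb.
exact: atom_mem_generators ga (generates_mem gb xb) x0 atx.
Qed.

Lemma numerical_semigroup_cofinite (S : set nat) :
  numerical_semigroup S -> exists c, forall n, S (c + n).
Proof.
move=> [_ _ /finite_seqP[F FS]]; exists (\max_(i <- F) i).+1 => n.
apply: contrapT => nS.
have /= : [set` F] ((\max_(i <- F) i).+1 + n) by rewrite -FS.
move=> /(@leq_bigmax_seq _ _ xpredT id) /(_ isT).
by rewrite addSn ltnNge leq_addr.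
Qed.

Lemma is_minimal_generators_ex (S : set nat) :
  numerical_semigroup S -> exists a, is_minimal_generators S a.
Proof.
move=> nS; have [c cS] := numerical_semigroup_cofinite nS.
have [S0 SD _] := nS.
pose atom x := 0 < x /\ forall y z, S y -> S z -> 0 < y -> 0 < z -> x <> y + z.
pose a := [seq x <- iota 0 (c.+1 + c.+1) | `[< S x /\ atom x >]].
have aP x : x \in a <-> S x /\ atom x.
  rewrite mem_filter mem_iota add0n /=; split=> [/andP[/asboolP]//|Sx].
  apply/andP; split; first exact/asboolP.
  rewrite ltnNge; apply/negP => lex; case: Sx => Sx [_ /(_ c.+1 (x - c.+1))].
  have le1 : c.+1 <= x by apply: leq_trans lex; rewrite leq_addr.
  have le2 : c.+1 <= x - c.+1 by rewrite leq_subRL.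
  apply => //; first by rewrite -addn1.
  - by rewrite -(subnKC (ltnW le2)).
  - by apply: leq_trans le2.
  - by rewrite subnKC.
exists a; split.
- by apply: sorted_filter; [exact: ltn_trans|exact: iota_ltn_sorted].
- move=> s; split; last first.
    by apply: factorizations_closed => // x /aP[].
  elim/ltn_ind: s => s IH Ss; have [->|s0] := posnP s.
    exact: factorizations0.
  have [/(conj Ss)/aP|] := pselect (atom s); first exact: factorizations_mem.
  move=> nat_s.
  have [y [z [Sy Sz y0 z0 syz]]] :
    exists y z, [/\ S y, S z, 0 < y, 0 < z & s = y + z].
    apply: contrapT => nyz; apply: nat_s; split=> // y z Sy Sz y0 z0 e.
    by apply: nyz; exists y, z.
  have [f fy] : factorizations a y !=set0.
    by apply: IH => //; rewrite syz -addn1 leq_add2l.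
  have [g gz] : factorizations a z !=set0.
    by apply: IH => //; rewrite syz -add1n leq_add2r.
  by exists [ffun i => f i + g i]; rewrite syz; apply: factorizationsD.
- move=> b _ gb x /aP[Sx [x0 atx]]; exact: atom_mem_generators gb Sx x0 atx.
Qed.

Lemma minimal_generatorsP (S : set nat) (a : seq nat) :
  numerical_semigroup S ->
  is_minimal_generators S a <-> minimal_generators S = a.
Proof.
move=> /is_minimal_generators_ex exa.
have mS : is_minimal_generators S (minimal_generators S).
  exact: (xgetPex [::] (P := [set a | is_minimal_generators S a])).
by split=> [/(is_minimal_generators_uniq mS)|<-].
Qed.

(* The minimum defining the catenary degree of an element is always attained. *)
Lemma element_catenary_degreeP (S : set nat) (s : nat) :
  numerical_semigroup S ->
  let a := minimal_generators S in
  let connected N := forall z z',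
    factorizations a s z -> factorizations a s z' -> is_chain s N z z' in
  connected (element_catenary_degree a s) /\
  forall N, connected N -> element_catenary_degree a s <= N.
Proof.
move=> nS a connected; apply: (@minimumP [set N | connected N]).
have ma : is_minimal_generators S a by apply/minimal_generatorsP.
exists s => z z' zs zs'; exists [:: z']; split=> //=.
  by move=> w; rewrite !inE => /orP[]/eqP->.
have le (u v : exponents a) : factorizations a s u -> flength (fsub u v) <= s.
  rewrite /factorizations /= => <-; apply: leq_sum => i _; rewrite ffunE.
  apply: (leq_trans (leq_subr _ _)); rewrite leq_pmulr //.
  by have [] := minimal_generator_atom ma (mem_nth 0 (ltn_ord i)).
by rewrite andbT /fdist geq_max !le.
Qed.

(* Main.v *)
(* Since p is prime, saturation puts every integer beyond the first element of S
   prime to p into S; hence S consists of the multiples of p and of all integers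
   >= ph, and its minimal generators are p, ph + 1, ..., ph + p - 1.  Two
   generators other than p can be traded for copies of p and at most one other
   generator, at distance at most 2h + 1.  Repeating this brings any
   factorization to the unique one that uses at most one generator other than p,
   so C(S) <= 2h + 1.  Conversely the factorization (2h + 1) * p of p(2h + 1) is
   disjoint from all the others, for instance (ph + 1) + (ph + p - 1). *)
Require Import Defs.
From mathcomp Require Import all_boot all_order.
From mathcomp Require Import boolp classical_sets cardinality.
From mathcomp Require Import zify.

Set Implicit Arguments.
Unset Strict Implicit.
Unset Printing Implicit Defensive.

Local Open Scope classical_set_scope.
Local Open Scope nat_scope.

Lemma supremum_max (A : set nat) m :
  A m -> (forall n, A n -> n <= m) -> supremum 0 A = m.
Proof.
move=> Am ub; have ubm : ubound A m by move=> n /ub; rewrite leEnat.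
have ne : supremums A !=set0 by exists m; split=> // n /(_ m Am).
apply/eqP; rewrite eqn_leq -!leEnat ge_supremum_Nmem // andbT.
rewrite /supremum; case: ifPn => // _; case: xgetP => // x _ [_ /(_ m ubm)].
exact.
Qed.

(** * Arithmetic of factorization vectors, their distances and chains *)

Section FactorizationMonoid.
Variable a : seq nat.
Implicit Types w x y z t : exponents a.

Definition fadd x y : exponents a := [ffun i => x i + y i].

(** The index is a plain natural number, so that computed indices such as i + j - p need no bound
    proof; out of range this is the zero vector. *)
Definition fpure (c k : nat) : exponents a :=
  [ffun i : 'I_(size a) => c * (i == k :> nat)].

Definition fval x : nat := \sum_(i < size a) x i * nth 0 a i.

Lemma faddA x y z : fadd x (fadd y z) = fadd (fadd x y) z.
Proof. by apply/ffunP => i; rewrite !ffunE addnA. Qed.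

Lemma fadd_fpure0 x k : fadd x (fpure 0 k) = x.
Proof. by apply/ffunP => i; rewrite !ffunE addn0. Qed.

Lemma fvalD x y : fval (fadd x y) = fval x + fval y.
Proof. by rewrite -big_split; apply: eq_bigr => i _; rewrite ffunE mulnDl. Qed.

Lemma flengthD x y : flength (fadd x y) = flength x + flength y.
Proof. by rewrite -big_split; apply: eq_bigr => i _; rewrite ffunE. Qed.

Lemma fval_pure c k : k < size a -> fval (fpure c k) = c * nth 0 a k.
Proof.
move=> lt_k; rewrite /fval (bigD1 (Ordinal lt_k)) //= ffunE eqxx muln1.
rewrite big1 ?addn0 // => i /negbTE ne; rewrite ffunE.
by rewrite -[_ == k]/(i == Ordinal lt_k) ne muln0.
Qed.

Lemma flength_pure c k : flength (fpure c k) <= c.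
Proof.
have [lt_k|le_k] := ltnP k (size a).
  rewrite /flength (bigD1 (Ordinal lt_k)) //= ffunE eqxx muln1.
  rewrite big1 ?addn0 // => i /negbTE ne; rewrite ffunE.
  by rewrite -[_ == k]/(i == Ordinal lt_k) ne muln0.
rewrite /flength big1 // => i _; rewrite ffunE ltn_eqF ?muln0 //.
exact: leq_trans le_k.
Qed.

Lemma fdistC x y : fdist x y = fdist y x.
Proof.
have C : fgcd x y = fgcd y x by apply/ffunP => i; rewrite !ffunE minnC.
by rewrite /fdist C maxnC.
Qed.

(** The common summand [w] lies below the gcd, so what is left on each side is bounded by [x] and
    [y]. *)
Lemma fdist_addl w x y :
  fdist (fadd w x) (fadd w y) <= maxn (flength x) (flength y).
Proof.
have le u v :
    flength (fsub (fadd w u) (fgcd (fadd w u) (fadd w v))) <= flength u.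
  by apply: leq_sum => i _; rewrite !ffunE; lia.
have C : fgcd (fadd w x) (fadd w y) = fgcd (fadd w y) (fadd w x).
  by apply/ffunP => i; rewrite !ffunE minnC.
rewrite /fdist geq_max !leq_max le /= C; apply/orP; right; exact: le.
Qed.

Lemma is_chain_refl s N z : factorizations a s z -> is_chain s N z z.
Proof. by move=> fz; exists [::]; split=> // w; rewrite inE => /eqP->. Qed.

Lemma is_chain_step s N z z' : factorizations a s z -> factorizations a s z' ->
  fdist z z' <= N -> is_chain s N z z'.
Proof.
move=> fz fz' le; exists [:: z']; split=> //=; last by rewrite le.
by move=> w; rewrite !inE => /orP[]/eqP->.
Qed.

Lemma is_chain_trans s N x y z :
  is_chain s N x y -> is_chain s N y z -> is_chain s N x z.
Proof.
move=> [us [fus pus lus]] [vs [fvs pvs lvs]]; exists (us ++ vs); split.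
- move=> w; rewrite -cat_cons mem_cat => /orP[/fus//|wv].
  by apply: fvs; rewrite inE wv orbT.
- by rewrite cat_path pus lus.
- by rewrite last_cat lus.
Qed.

Lemma is_chain_sym s N x y : is_chain s N x y -> is_chain s N y x.
Proof.
move=> [us [fus pus <-]]; exists (rev (belast x us)); split.
- by move=> w; rewrite -rev_rcons -lastI mem_rev; apply: fus.
- by rewrite rev_path; under eq_path do rewrite fdistC.
- by case: us {fus pus} => //= u us; rewrite rev_cons last_rcons.
Qed.

(** The first member of the chain that differs from [z] is preceded by [z]. This gives lower bounds
    on N: a factorization far from all others forces a long step. *)
Lemma is_chain_exit s N z z' : is_chain s N z z' -> z <> z' ->
  exists w, [/\ factorizations a s w, w <> z & fdist z w <= N].
Proof.
move=> [us]; elim: us => [|u us IH] [fus /= pus lus] ne; first by case: ne.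
have /andP[le_u {}pus] := pus.
have [uz|/eqP uz] := eqVneq u z; last first.
  by exists u; split=> //; apply: fus; rewrite !inE eqxx orbT.
subst u; apply: IH => //; split=> // w w_us; apply: fus.
by rewrite inE w_us orbT.
Qed.

(** Index 0 will carry the multiplicity p. A factorization is in normal form when this count is at
    most 1; otherwise a trade lowers it. *)
Definition ftail x : nat := \sum_(i < size a | i != 0 :> nat) x i.

Lemma ftailD x y : ftail (fadd x y) = ftail x + ftail y.
Proof. by rewrite -big_split; apply: eq_bigr => i _; rewrite ffunE. Qed.

Lemma ftail_pure0 c : ftail (fpure c 0) = 0.
Proof. by rewrite /ftail big1 // => i /negbTE ne; rewrite ffunE ne muln0. Qed.

Lemma ftail_pure c k : ftail (fpure c k) <= c.
Proof.
apply: leq_trans (flength_pure c k).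
by rewrite /ftail /flength big_mkcond; apply: leq_sum => i _; case: ifP.
Qed.

Lemma ftail_pure1 (k : 'I_(size a)) : k != 0 :> nat -> ftail (fpure 1 k) = 1.
Proof.
move=> k0; rewrite /ftail (bigD1 k) //= ffunE eqxx big1 ?addn0 //.
move=> i /andP[_ /negbTE ne]; rewrite ffunE.
by rewrite -[nat_of_ord _ == _]/(i == k) ne.
Qed.

Lemma ftail_eq0 z : ftail z = 0 -> exists c, z = fpure c 0.
Proof.
move=> /eqP; rewrite sum_nat_eq0 => /forallP z0.
have [a0|a_gt0] := posnP (size a).
  by exists 0; apply/ffunP => -[i lt_i]; exfalso; rewrite a0 in lt_i.
exists (z (Ordinal a_gt0)); apply/ffunP => i; rewrite ffunE.
have /implyP := z0 i; have [i0|_ /(_ isT)/eqP->] := eqVneq (i : nat) 0.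
  by rewrite muln1 => _; congr (z _); apply: val_inj.
by rewrite muln0.
Qed.

Lemma ftail_gt0 z : 0 < ftail z -> exists (k : 'I_(size a)) w,
  [/\ 0 < k, z = fadd w (fpure 1 k) & ftail z = (ftail w).+1].
Proof.
rewrite lt0n sum_nat_eq0 negb_forall => /existsP[k]; rewrite negb_imply.
move=> /andP[k0 zk].
have zE : z = fadd (fsub z (fpure 1 k)) (fpure 1 k).
  apply/ffunP => i; rewrite !ffunE mul1n subnK //.
  have [ik|//] := eqVneq (i : nat) k.
  by rewrite (val_inj ik : i = k) lt0n.
exists k, (fsub z (fpure 1 k)); split=> //; first by rewrite lt0n.
by rewrite [in LHS]zE ftailD ftail_pure1 // addn1.
Qed.

End FactorizationMonoid.

Arguments fpure : clear implicits.

(** * Normal forms and chains over the generators p, ph + 1, ..., ph + p - 1 *)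

Section SaturatedGenerators.
Variables (p h : nat) (a : seq nat).
Hypotheses (p_gt1 : 1 < p) (h_gt0 : 0 < h) (size_a : size a = p).
Hypothesis nth_a0 : nth 0 a 0 = p.
Hypothesis nth_aS : forall k, 0 < k < p -> nth 0 a k = p * h + k.
Implicit Types w x y z t : exponents a.

Let fval_p c : fval (fpure a c 0) = c * p.
Proof. by rewrite fval_pure ?nth_a0 // size_a ltnW. Qed.

Let fval_k k : 0 < k < p -> fval (fpure a 1 k) = p * h + k.
Proof.
by move=> kp; rewrite fval_pure ?nth_aS ?mul1n ?size_a //; case/andP: kp.
Qed.

(** The coefficient [0 < k] covers both normal forms at once: k = 0 means that p is the only
    generator used. *)
Lemma normal_fval c k : k < p ->
  fval (fadd (fpure a c 0) (fpure a (0 < k) k)) = (c + h * (0 < k)) * p + k.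
Proof.
move=> lt_k; rewrite fvalD fval_p; case: posnP => [->|k0].
  by rewrite fval_p muln0 !addn0.
by rewrite fval_k ?k0 //; lia.
Qed.

Lemma ftail_le1 z : ftail z <= 1 ->
  exists c k, k < p /\ z = fadd (fpure a c 0) (fpure a (0 < k) k).
Proof.
have [/ftail_eq0[c ->] _|] := posnP (ftail z).
  by exists c, 0; rewrite fadd_fpure0; split=> //; apply: ltnW.
move=> /ftail_gt0[k [w [k0 -> ->]]]; rewrite ltnS leqn0 => /eqP/ftail_eq0[c ->].
by exists c, k; rewrite k0 -size_a.
Qed.

(** The value modulo p determines k, and then the value itself determines the number of copies of
    p. *)
Lemma normal_uniq z z' : ftail z <= 1 -> ftail z' <= 1 -> fval z = fval z' ->
  z = z'.
Proof.
move=> /ftail_le1[c [k [lt_k ->]]] /ftail_le1[c' [k' [lt_k' ->]]].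
rewrite !normal_fval // => e.
have ek : k = k'.
  by have /(congr1 (modn^~ p)) := e; rewrite !modnMDl !modn_small.
subst k'; congr fadd; congr fpure; apply/eqP.
move/eqP: e; rewrite eqn_add2r eqn_pmul2r ?eqn_add2r //; lia.
Qed.

(** The sum is 2ph + i + j. The new length is h + 1 if i + j < p, h + 2 if i + j > p (at most 2h + 1
    since h is positive), and 2h + 1 if i + j = p. *)
Lemma trade (i j : nat) : 0 < i < p -> 0 < j < p ->
  exists t, [/\ fval t = fval (fadd (fpure a 1 i) (fpure a 1 j)),
                flength t <= 2 * h + 1 & ftail t <= 1].
Proof.
move=> ip jp; rewrite fvalD !fval_k //.
have bound c k d : c + d <= 2 * h + 1 -> d <= 1 ->
    flength (fadd (fpure a c 0) (fpure a d k)) <= 2 * h + 1 /\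
    ftail (fadd (fpure a c 0) (fpure a d k)) <= 1.
  move=> le1 le2; rewrite flengthD ftailD ftail_pure0 add0n; split.
    by apply: leq_trans le1; rewrite leq_add ?flength_pure.
  by apply: leq_trans le2; apply: ftail_pure.
have [lt|gt|eq] := ltngtP (i + j) p.
- exists (fadd (fpure a h 0) (fpure a 1 (i + j))).
  have [|//|le1 le2] := bound h (i + j) 1; first by lia.
  by split=> //; rewrite fvalD fval_p fval_k; lia.
- exists (fadd (fpure a h.+1 0) (fpure a 1 (i + j - p))).
  have [|//|le1 le2] := bound h.+1 (i + j - p) 1; first by lia.
  by split=> //; rewrite fvalD fval_p fval_k; lia.
- exists (fadd (fpure a (2 * h + 1) 0) (fpure a 0 0)).
  have [|//|le1 le2] := bound (2 * h + 1) 0 0; first by lia.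
  by split=> //; rewrite fvalD !fval_p; lia.
Qed.

(** Induction on [ftail]: each trade replaces two generators other than p by at most one. *)
Lemma is_chain_normal s z : factorizations a s z ->
  exists z', [/\ factorizations a s z', ftail z' <= 1 &
                 is_chain s (2 * h + 1) z z'].
Proof.
have [n] := ubnP (ftail z); elim: n z => // n IH z lt_n fz.
have [le1|gt1] := leqP (ftail z) 1.
  by exists z; split=> //; apply: is_chain_refl.
have [i [w1 [i0 zE tz]]] := ftail_gt0 (ltnW gt1).
have [|j [w [j0 w1E tw1]]] := @ftail_gt0 a w1; first by lia.
have lt_p (k : 'I_(size a)) : k < p by rewrite -[X in _ < X]size_a.
have [||t [tv tl tt]] := @trade j i; rewrite ?i0 ?j0 ?lt_p //.
have {}zE : z = fadd w (fadd (fpure a 1 j) (fpure a 1 i)).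
  by rewrite zE w1E faddA.
have ft : factorizations a s (fadd w t).
  have vz : fval z = s := fz.
  by rewrite /factorizations /= -/(fval _) -vz zE !fvalD tv fvalD.
have [||z' [fz' tz' cz']] := IH (fadd w t) => //.
  by rewrite ftailD; lia.
exists z'; split=> //; apply: is_chain_trans cz'; apply: is_chain_step => //.
(* Only the traded parts count: [t], and two generators of total length at most 2 <= 2h + 1. *)
rewrite zE; apply: leq_trans (fdist_addl _ _ _) _; rewrite geq_max tl andbT.
rewrite flengthD.
by have := flength_pure a 1 j; have := flength_pure a 1 i; lia.
Qed.

Lemma is_chain_upper s z z' : factorizations a s z -> factorizations a s z' ->
  is_chain s (2 * h + 1) z z'.
Proof.
move=> /is_chain_normal[u [fu tu cu]] /is_chain_normal[v [fv tv cv]].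
apply: is_chain_trans cu _; rewrite (@normal_uniq u v) //.
  exact: is_chain_sym.
by rewrite /fval fu fv.
Qed.

Lemma is_chain_lower N :
  (forall z z', factorizations a (p * (2 * h + 1)) z ->
     factorizations a (p * (2 * h + 1)) z' ->
     is_chain (p * (2 * h + 1)) N z z') ->
  2 * h + 1 <= N.
Proof.
set z0 := fpure a (2 * h + 1) 0.
set z1 := fadd (fpure a 1 1) (fpure a 1 p.-1).
have o_gt0 : 0 < size a by rewrite size_a ltnW.
pose o := Ordinal o_gt0.
have f0 : factorizations a (p * (2 * h + 1)) z0.
  by rewrite /factorizations /= -/(fval z0) fval_p mulnC.
have f1 : factorizations a (p * (2 * h + 1)) z1.
  by rewrite /factorizations /= -/(fval z1) fvalD !fval_k; lia.
move=> /(_ z0 z1 f0 f1)/is_chain_exit[].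
  by move=> /ffunP/(_ o); rewrite !ffunE /=; lia.
move=> w [fw wz0 le]; apply: leq_trans le.
(* If [w] contains no copy of p, its gcd with [z0] vanishes at [o], and all 2h + 1 copies of p in
   [z0] count in the distance. *)
suff w0 : w o = 0.
  rewrite /fdist leq_max; apply/orP; left.
  by rewrite /flength (bigD1 o) //= !ffunE w0 minn0 subn0 muln1 leq_addr.
have {}fw : fval w = p * (2 * h + 1) := fw.
have [le1|gt1] := leqP (ftail w) 1.
  case: wz0; apply: normal_uniq; rewrite ?ftail_pure0 //.
  by rewrite fw [RHS]f0.
have [i [w1 [i0 wE tw]]] := ftail_gt0 (ltnW gt1).
have [|j [w2 [j0 w1E _]]] := @ftail_gt0 a w1; first by lia.
have lt_p (k : 'I_(size a)) : k < p by rewrite -[X in _ < X]size_a.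
have w20 : w o = w2 o by rewrite wE w1E !ffunE /= !ltn_eqF // !addn0.
(* Two generators ph + i and ph + j leave only p - i - j < p for [w2], too little for a copy of
   p. *)
have le2 : w2 o * p <= fval w2.
  by rewrite /fval (bigD1 o) //= nth_a0 leq_addr.
rewrite w20; move: fw; rewrite wE w1E !fvalD !fval_k ?i0 ?j0 ?lt_p // => fw.
by move: le2; case: (w2 o) => // n; rewrite mulSn; lia.
Qed.

End SaturatedGenerators.

(** * Elements and minimal generators of the saturated semigroup *)

Definition saturated_generators p h := p :: [seq p * h + k | k <- iota 1 p.-1].

Lemma size_saturated_generators p h :
  0 < p -> size (saturated_generators p h) = p.
Proof. by move=> p_gt0; rewrite /= size_map size_iota prednK. Qed.

Lemma nth_saturated_generators p h k :
  0 < k < p -> nth 0 (saturated_generators p h) k = p * h + k.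
Proof.
by case: k => // k kp; rewrite /= (nth_map 0) ?size_iota ?nth_iota //; lia.
Qed.

Section SaturatedPrime.
Variables (p h : nat) (S : set nat).
Hypotheses (p_prime : prime p) (S_num : numerical_semigroup S).
Hypotheses (S_sat : saturated S) (S_mult : multiplicity S = p).
Hypotheses (h_gt0 : 0 < h) (S_cond : conductor S = p * h).

(** If p does not divide s in S, then from s on the gcd in the definition of saturation is 1, so S
    contains every integer >= s and the conductor is at most s. *)
Lemma saturated_prime_mem s : S s <-> p %| s \/ p * h <= s.
Proof.
have [c cS] := numerical_semigroup_cofinite S_num; have [S0 SD _] := S_num.
have [[Sp p_gt0] p_min] : (S p /\ 0 < p) /\
    forall m, S m /\ 0 < m -> p <= m.
  rewrite -S_mult; apply: (@minimumP [set s | S s /\ 0 < s]).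
  by exists (c + 1); split=> //; rewrite addn1.
have [phS ph_min] : (forall n, S (p * h + n)) /\
    forall m, (forall n, S (m + n)) -> p * h <= m.
  rewrite -S_cond; apply: (@minimumP [set s | forall n, S (s + n)]).
  by exists c.
split=> [Ss|[/dvdnP[k ->]|le]]; last by rewrite -(subnKC le).
  have [dv|ndv] := boolP (p %| s); [by left|right].
  have s_gt0 : 0 < s by rewrite lt0n; apply: contraNneq ndv => ->.
  apply: ph_min; elim=> [|n Sn]; first by rewrite addn0.
  have dvd_gcd x : S x -> x <= s + n -> gcd_upto S (s + n) %| x.
    move=> Sx; rewrite -ltnS => lt_x.
    by apply: (biggcdn_inf (Ordinal lt_x)) => //=; apply/mem_set.
  suff g1 : gcd_upto S (s + n) = 1.
    by rewrite addnS -addn1 -g1; apply: S_sat => //; rewrite addn_gt0 s_gt0.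
  have /(dvd_gcd _ Ss) gs := leq_addr n s.
  (* As the multiplicity, p is at most s and so takes part in the gcd. *)
  have gp : gcd_upto S (s + n) %| p.
    by apply: dvd_gcd => //; apply: leq_trans (leq_addr n s); apply: p_min.
  case/primeP: p_prime => _ /(_ _ gp)/orP[/eqP//|/eqP gE].
  by rewrite gE (negbTE ndv) in gs.
by elim: k => // k IH; rewrite mulSn; apply: SD.
Qed.

Lemma minimal_generators_saturated :
  minimal_generators S = saturated_generators p h.
Proof.
have p_gt1 := prime_gt1 p_prime.
have size_a := size_saturated_generators h (ltnW p_gt1).
apply/minimal_generatorsP => //.
have aP x : x \in saturated_generators p h ->
    x = p \/ exists2 k, 0 < k < p & x = p * h + k.
  rewrite inE => /orP[/eqP|/mapP[k]]; first by left.
  by rewrite mem_iota => kp ->; right; exists k => //; lia.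
have aS x : x \in saturated_generators p h -> S x.
  move=> /aP[->|[k kp ->]]; apply/saturated_prime_mem; first by left.
  by right; rewrite leq_addr.
have [S0 SD _] := S_num.
have ge_p y : S y -> 0 < y -> p <= y.
  move=> /saturated_prime_mem[/dvdn_leq le /le//|le _].
  by apply: leq_trans le; rewrite leq_pmulr.
split.
- rewrite /= path_sortedE; last exact: ltn_trans.
  apply/andP; split.
    apply/allP => _ /mapP[k + ->]; rewrite mem_iota => /andP[k0 _] /=.
    by rewrite -addn1 leq_add // leq_pmulr.
  apply: homo_sorted (iota_ltn_sorted _ _) => x y /=.
  by rewrite ltn_add2l.
- move=> s; split; last first.
    by apply: factorizations_closed => // x xa _; apply: aS.
  have H := @normal_fval p h (saturated_generators p h) p_gt1 h_gt0
    size_a erefl (@nth_saturated_generators p h).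
  have fac c k : k < p ->
      factorizations (saturated_generators p h)
        ((c + h * (0 < k)) * p + k) !=set0.
    by move=> lt_k; eexists; apply: (H c k).
  move=> Ss; rewrite (divn_eq s p).
  have lt_m : s %% p < p by rewrite ltn_mod ltnW.
  (* A nonzero remainder k forces s >= ph, so the quotient is at least h and h copies of p can be
     absorbed into ph + k. *)
  suff le : h * (0 < s %% p) <= s %/ p by rewrite -(subnK le); apply: fac.
  case: posnP => [_|m_gt0]; first by rewrite muln0.
  rewrite muln1 leq_divRL ?(ltnW p_gt1) //.
  by move/saturated_prime_mem: Ss; rewrite /dvdn mulnC => -[/eqP|//]; lia.
(* Each listed generator is an atom: in x = y + z both parts are at least p, which excludes x = p;
   for x = ph + k both are then below ph, hence multiples of p, although p does not divide k. *)
- move=> b _ gb x xa; apply: atom_mem_generators gb (aS x xa) _ _.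
    by move: (aP x xa) => [->|[k kp ->]]; lia.
  move=> y z Sy Sz y0 z0 xE.
  have le_y := ge_p y Sy y0; have le_z := ge_p z Sz z0.
  case: (aP x xa) => [|[k kp xE']]; first by lia.
  move/saturated_prime_mem: Sy => [dy|]; last by lia.
  move/saturated_prime_mem: Sz => [dz|]; last by lia.
  have : p %| p * h + k by rewrite -xE' xE dvdn_add.
  by rewrite dvdn_addr ?dvdn_mulr // => /dvdn_leq; lia.
Qed.

End SaturatedPrime.

Theorem theorem2 (p h : nat) (S : set nat) :
  prime p ->
  numerical_semigroup S ->
  saturated S ->
  multiplicity S = p ->
  0 < h ->
  conductor S = p * h ->
  catenary_degree S = 2 * h + 1.
Proof.
move=> p_prime S_num S_sat S_mult h_gt0 S_cond.
have p_gt1 := prime_gt1 p_prime.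
have size_a := size_saturated_generators h (ltnW p_gt1).
have nth_a := @nth_saturated_generators p h.
have genS :=
  minimal_generators_saturated p_prime S_num S_sat S_mult h_gt0 S_cond.
have le_C s : element_catenary_degree (minimal_generators S) s <= 2 * h + 1.
  have [_] := element_catenary_degreeP s S_num; apply; rewrite genS => z z'.
  exact: (is_chain_upper p_gt1 h_gt0 size_a erefl nth_a).
apply: supremum_max => [|_ [s _ <-]//].
(* The supremum is attained at the element where (2h + 1) * p is isolated. *)
exists (p * (2 * h + 1)).
  apply/(saturated_prime_mem p_prime S_num S_sat S_mult S_cond).
  by left; rewrite dvdn_mulr.
apply/eqP; rewrite eqn_leq le_C /=.
have [+ _] := element_catenary_degreeP (p * (2 * h + 1)) S_num.
by rewrite genS; apply: (is_chain_lower p_gt1 h_gt0 size_a erefl nth_a).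
Qed.
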